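(* Let $1\le k<n$ and let $$A=\begin{bmatrix}\widehat\Lambda & E^{T}\\ E & A_2\end{bmatrix}\in\mathbb{R}^{n\times n}$$ be a symmetric matrix, where $\widehat\Lambda=\mathrm{diag}(\theta_1,\ldots,\theta_k)\in\mathbb{R}^{k\times k}$, $E=[E_1,E_2,\ldots,E_k]\in\mathbb{R}^{(n-k)\times k}$ has columns $E_1,\dots,E_k$, and $A_2\in\mathbb{R}^{(n-k)\times(n-k)}$ is symmetric. For $i\in\{1,\ldots,k\}$, suppose that $$\delta_i=\min_{j}|\theta_i-\lambda_j(A_2)|-\|E_i\|_2>0,$$ $$\delta_{i,j}=|\theta_i-\theta_j|-\|E_i\|_2>0\quad\text{for all } 1\le j\le k,\ j\neq i,$$ and further that $$d_i=\frac{1}{\delta_i-\displaystyle\sum_{1\le j\le k,\ j\ne i}\frac{\|E_j\|_2^2}{\delta_{i,j}}}>0.$$ Then there exists an eigenvalue $\lambda_i$ of $A$ satisfying $$|\lambda_i-\theta_i|\le d_i\,\|E_i\|_2^2 .$$ If these hypotheses hold for every $i=1,\ldots,k$, the values $\theta_i$ and the eigenvalues $\lambda_i$ have a one-to-one correspondence, i.e. the $\lambda_1,\dots,\lambda_k$ can be chosen to be $k$ eigenvalues of $A$ counted with multiplicity (at $k$ different positions in the ordered list of the $n$ eigenvalues of $A$). Moreover, for $t\in[0,1]$ let $A^{(i)}(t)$ be the symmetric matrix obtained from $A$ by replacing the column $E_i$ of $E$ by $tE_i$ (and correspondingly the row $E_i^T$ of $E^T$ by $tE_i^T$), and let $x(t)\neq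 0$ and $\lambda_i(t)$ be continuous functions of $t\in[0,1]$ with $A^{(i)}(t)x(t)=\lambda_i(t)x(t)$ and $\lambda_i(0)=\theta_i$. Then, with $\lambda_i=\lambda_i(1)$, the bound $|\lambda_i-\theta_i|\le d_i\|E_i\|_2^2$ holds with the specific $\delta_i,\delta_{i,j}$ above replaced by any numbers $\delta_i$, $\delta_{i,j}$ ($1\le j\le k$, $j\ne i$) such that $$0<\delta_i\le\min_{j,\ 0\le t\le 1}|\lambda_i(t)-\lambda_j(A_2)|,\qquad 0<\delta_{i,j}\le\min_{0\le t\le1}|\lambda_i(t)-\theta_j|,$$ where $d_i$ is given by the same formula in terms of these numbers and is assumed to satisfy $d_i>0$.
   Context: $\|\cdot\|_2$ denotes the Euclidean norm of a vector (spectral norm of a matrix). $\lambda_j(A_2)$, $j=1,\dots,n-k$, are the eigenvalues of $A_2$. The $\theta_i$ are called Ritz values. *)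

(* Defs.v *)
From mathcomp Require Import all_boot all_order all_algebra.
From mathcomp Require Import polyrcf complex.
From mathcomp Require Import all_classical all_reals all_analysis.

Set Implicit Arguments.
Unset Strict Implicit.
Unset Printing Implicit Defensive.

Import Order.TTheory GRing.Theory Num.Theory.
Import numFieldNormedType.Exports.

Local Open Scope ring_scope.

Section Eigenvalues.
Context {R : rcfType}.

(* The real eigenvalues of A in nondecreasing order, each repeated as often as
   its multiplicity as a root of the characteristic polynomial. For symmetric A
   these are all the eigenvalues: see char_poly_eigval below. *)
Definition eigenvalues (n : nat) (A : 'M[R]_n) : seq R :=
  flatten [seq nseq (mup x (char_poly A)) x | x <- rootsR (char_poly A)].

Definition eigval (n : nat) (A : 'M[R]_n) (j : 'I_n) : R := (eigenvalues A)`_j.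

Lemma eigenvalues_sorted (n : nat) (A : 'M[R]_n) : sorted <=%R (eigenvalues A).
Proof.
rewrite /eigenvalues; set p := char_poly A.
have := sorted_roots (- cauchy_bound p) (cauchy_bound p) p.
rewrite -/(rootsR p) lt_sorted_pairwise le_sorted_pairwise.
elim: (rootsR p) => //= x s IH /andP[/allP xs /IH {}IH].
rewrite pairwise_cat IH andbT; apply/andP; split.
  apply/allrelP => a b /nseqP[-> _] /flattenP[_ /mapP[y ys ->]] /nseqP[-> _].
  exact/ltW/xs.
by elim: (mup x p) => //= m ->; rewrite andbT; apply/allP => y /nseqP[-> _].
Qed.

Lemma count_flatten_nseq (f : R -> nat) (r : seq R) (x : R) : uniq r ->
  count_mem x (flatten [seq nseq (f y) y | y <- r]) =
  (if x \in r then f x else 0)%N.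
Proof.
elim: r => //= y r IH /andP[yr /IH {}IH].
rewrite count_cat count_nseq IH in_cons /= eq_sym.
have [->|xy] := eqVneq x y; last by [].
by rewrite (negPf yr) mul1n addn0.
Qed.

Lemma perm_eigenvalues (n : nat) (A : 'M[R]_n) (s : seq R) :
  char_poly A = \prod_(x <- s) ('X - x%:P) -> perm_eq (eigenvalues A) s.
Proof.
rewrite /eigenvalues => ->; set p := \prod_(_ <- _) _.
have p0 : p != 0 by rewrite monic_neq0 // monic_prod_XsubC.
apply/allP => x _ /=; apply/eqP.
rewrite count_flatten_nseq; last by apply: (sorted_uniq lt_trans (@ltxx _ _)); exact: sorted_roots.
rewrite -mu_prod_XsubC -/p -roots_on_rootsR // in_itv /=.
by case: ifPn => // /mupNroot.
Qed.

Lemma symmetric_char_poly_split (n : nat) (A : 'M[R]_n) : A^T = A ->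
  {s : seq R | char_poly A = \prod_(x <- s) ('X - x%:P)}.
Proof.
move=> As; pose C := (R[i])%C; pose f := real_complex R.
pose Ac : 'M[C]_n := map_mx f A.
have Acr : Ac \is a mxOver Num.real.
  by apply/mxOverP => i j; rewrite mxE complex_real.
have Ach : Ac \is hermsymmx.
  apply: realsym_hermsym => //; apply/is_hermitianmxP.
  by rewrite expr0 scale1r map_mx_id //; apply/matrixP => i j; rewrite !mxE -{1}As mxE.
have := orthomx_spectralP (hermitian_normalmx Ach).
have Dr := hermitian_spectral_diag_real Ach.
have Pu := spectral_unit Ac.
move: (spectralmx Ac) (spectral_diag Ac) Dr Pu => P D Dr Pu AE.
have cE : char_poly Ac = \prod_(i < n) ('X - (D 0 i)%:P).
  have -> : char_poly Ac = char_poly (diag_mx D).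
    rewrite /char_poly /char_poly_mx.
    have -> : 'X%:M - map_mx polyC Ac =
      map_mx polyC (invmx P) *m ('X%:M - map_mx polyC (diag_mx D))
      *m map_mx polyC P.
      rewrite mulmxBr mulmxBl scalar_mxC -!mulmxA -!map_mxM (mulmxA (invmx P)) -AE.
      by rewrite mulVmx // map_mx1 mulmx1.
    rewrite !det_mulmx mulrAC mulrC -det_mulmx -map_mxM mulVmx //.
    by rewrite map_mx1 det1 mulr1.
  rewrite char_poly_trig; last exact/is_diag_mx_is_trig/diag_mx_is_diag.
  by apply: eq_bigr => i _; rewrite mxE eqxx mulr1n.
exists [seq complex.Re (D 0 i) | i <- enum 'I_n].
apply: (map_poly_inj f); rewrite map_char_poly -/Ac cE rmorph_prod /=.
rewrite big_map big_enum /=; apply: eq_bigr => i _.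
rewrite rmorphB /= map_polyX map_polyC /=; congr ('X - _%:P).
have /mxOverP/(_ 0 i) := Dr.
by move=> /RRe_real <-.
Qed.

Lemma size_eigenvalues (n : nat) (A : 'M[R]_n) : A^T = A ->
  size (eigenvalues A) = n.
Proof.
move=> /symmetric_char_poly_split[s sE]; rewrite (perm_size (perm_eigenvalues sE)).
by have := size_char_poly A; rewrite sE size_prod_XsubC => -[].
Qed.

Lemma char_poly_eigval (n : nat) (A : 'M[R]_n) : A^T = A ->
  char_poly A = \prod_(j < n) ('X - (eigval A j)%:P).
Proof.
move=> As; have [s sE] := symmetric_char_poly_split As.
rewrite sE -(perm_big _ (perm_eigenvalues sE)) /= (big_nth 0).
by rewrite size_eigenvalues // big_mkord.
Qed.

End Eigenvalues.

Section RitzValues.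
Context {R : realType}.

Definition norm2 (m : nat) (v : 'cV[R]_m) : R :=
  Num.sqrt (\sum_(a < m) v a 0 ^+ 2).

Definition ritz_mx (k m : nat) (theta : 'rV[R]_k) (E : 'M[R]_(m, k))
    (A2 : 'M[R]_m) : 'M[R]_(k + m) :=
  block_mx (diag_mx theta) E^T E A2.

Definition scale_col (k m : nat) (i : 'I_k) (t : R) (E : 'M[R]_(m, k)) :
    'M[R]_(m, k) :=
  \matrix_(a, b) (if b == i then t * E a b else E a b).

(* The infimum is a minimum: for 0 < m it is over a nonempty finite set. *)
Definition delta (k m : nat) (theta : 'rV[R]_k) (E : 'M[R]_(m, k))
    (A2 : 'M[R]_m) (i : 'I_k) : R :=
  inf (range (fun j : 'I_m => `|theta 0 i - eigval A2 j|)) - norm2 (col i E).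

Definition delta2 (k m : nat) (theta : 'rV[R]_k) (E : 'M[R]_(m, k))
    (i j : 'I_k) : R :=
  `|theta 0 i - theta 0 j| - norm2 (col i E).

(* dl and dl2 j stand for delta_i and delta_{i,j}; dl2 i is never used. *)
Definition dfactor (k m : nat) (E : 'M[R]_(m, k)) (i : 'I_k)
    (dl : R) (dl2 : 'I_k -> R) : R :=
  1 / (dl - \sum_(j < k | j != i) norm2 (col j E) ^+ 2 / dl2 j).

Definition ritz_separated (k m : nat) (theta : 'rV[R]_k) (E : 'M[R]_(m, k))
    (A2 : 'M[R]_m) (i : 'I_k) : Prop :=
  [/\ 0 < delta theta E A2 i,
      forall j : 'I_k, j != i -> 0 < delta2 theta E i j
    & 0 < dfactor E i (delta theta E A2 i) (delta2 theta E i)].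

Definition ritz_bound (k m : nat) (theta : 'rV[R]_k) (E : 'M[R]_(m, k))
    (A2 : 'M[R]_m) (i : 'I_k) : R :=
  dfactor E i (delta theta E A2 i) (delta2 theta E i) * norm2 (col i E) ^+ 2.

End RitzValues.

(* Main.v *)
(* Let (u, y) be an eigenvector of the ritz matrix for l. Eliminating
   u_j = E_j.y / (l - theta_j) for j != i from the lower block equation gives
   |y| <= d_i |E_i| |u_i|, and the i-th upper equation then bounds
   |l - theta_i|. This only needs l to be far from the other theta_j and from
   the spectrum of A2, so for a continuous path it suffices to look at t = 1.

   An eigenvalue within |E_i| of theta_i is located by its index. The Schur
   complement of the other theta_j - theta_i in A - theta_i is a perturbation of
   A2 - theta_i by less than delta_i, so when E_i = 0 exactly
   p_i = #{j | theta_j < theta_i} + #{j | lambda_j(A2) < theta_i} eigenvalues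
   lie below theta_i, and restoring E_i moves the eigenvalue of index p_i
   (counting from 0) by at most |E_i|. Distinct theta_i have distinct p_i. *)
Require Import Defs.
From mathcomp Require Import all_boot all_order all_algebra.
From mathcomp Require Import all_classical all_reals all_analysis.
From mathcomp Require Import ring lra zify.

Import Order.TTheory GRing.Theory Num.Theory.
Import numFieldNormedType.Exports.

Local Open Scope classical_set_scope.
Local Open Scope ring_scope.

Section RitzPerturbation.

Set Implicit Arguments.
Unset Strict Implicit.

(** * Orthogonal diagonalization of symmetric matrices over a real closed field *)

Lemma sqr_rV_gt0 (R : realDomainType) (n : nat) (v : 'rV[R]_n) :
  v != 0 -> 0 < (v *m v^T) 0 0.
Proof.
move=> v0; rewrite lt_neqAle; apply/andP; split; last first.
  by rewrite mxE sumr_ge0 // => j _; rewrite mxE -expr2 sqr_ge0.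
apply: contra v0; rewrite eq_sym mxE psumr_eq0 => [/allP v0|j _]; last first.
  by rewrite mxE -expr2 sqr_ge0.
apply/eqP/rowP => j; rewrite mxE.
by have := v0 j (mem_index_enum j); rewrite mxE -expr2 sqrf_eq0 => /eqP.
Qed.

(* A Householder reflection exchanges w and the i-th basis vector. *)
Lemma orthogonal_with_row (R : realFieldType) (n : nat) (i : 'I_n)
    (w : 'rV[R]_n) : (w *m w^T) 0 0 = 1 ->
  exists2 H : 'M[R]_n, H *m H^T = 1%:M & row i H = w.
Proof.
move=> w1; pose e : 'rV[R]_n := delta_mx 0 i.
have [u uE] : exists u, u = w - e by exists (w - e).
have [u0|u0] := eqVneq u 0.
  exists 1%:M; first by rewrite trmx1 mulmx1.
  by rewrite row1; apply/esym/eqP; rewrite -subr_eq0 -/e -uE u0.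
have s0 := sqr_rV_gt0 u0; set s := (u *m u^T) 0 0 in s0.
have uu : u *m u^T = s%:M by rewrite [LHS]mx11_scalar.
have sE : s = 2 * (1 - w 0 i).
  rewrite /s uE linearB /= mulmxBl !mulmxBr !mxE.
  rewrite -[X in X - _ - _]/(\sum_j _).
  have -> : \sum_j w 0 j * w^T j 0 = 1 by rewrite -w1 mxE.
  have eE (a : 'rV[R]_n) : (a *m e^T) 0 0 = a 0 i.
    rewrite mxE (bigD1 i) //= big1 => [|j ji].
      by rewrite !mxE !eqxx mulr1 addr0.
    by rewrite !mxE (negPf ji) andbF mulr0.
  have := eE w; rewrite mxE => ->.
  have := eE e; rewrite mxE => ->.
  (* The other cross term, [e *m w^T], is the transpose of a one by one matrix already evaluated. *)
  have := eE w; rewrite -[in X in X -> _](trmxK (w *m e^T)) mxE trmx_mul.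
  rewrite trmxK mxE => ->.
  by rewrite mxE !eqxx /=; ring.
have [c cE] : exists c, c = 2 / s by eexists.
have [H HE] : exists H, H = 1%:M - c *: (u^T *m u) by eexists.
have HT : H^T = H by rewrite HE linearB /= trmx1 linearZ /= trmx_mul trmxK.
exists H.
  rewrite HT HE mulmxBl mul1mx mulmxBr mulmx1.
  rewrite -!scalemxAl -!scalemxAr -mulmxA (mulmxA u) uu mul_scalar_mx.
  rewrite -scalemxAr !scalerA opprB -addrA -[RHS]addr0; congr (_ + _).
  rewrite -!scaleNr -!scalerDl.
  have -> : - c + (c * (c * s) - c) = 0 by rewrite cE; field; lra.
  by rewrite scale0r.
rewrite HE linearB /= row1 linearZ /= row_mul -/e.
have -> : row i u^T = (w 0 i - 1)%:M.
  by rewrite [LHS]mx11_scalar !mxE uE !mxE !eqxx.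
rewrite mul_scalar_mx scalerA.
have -> : c * (w 0 i - 1) = -1 by rewrite cE sE; field; lra.
by rewrite scaleN1r opprK uE addrC subrK.
Qed.

(** Deflation, by induction on [s]: a unit eigenvector for the head [x] is the first row of an
    orthogonal [H], and [H *m A *m H^T] splits off [x], leaving a smaller symmetric matrix. The
    diagonal follows the order of [s], so a sorted list yields a sorted diagonal. *)
Lemma symmetric_diagonalization (R : rcfType) (s : seq R) (n : nat)
    (A : 'M[R]_n) :
  A^T = A -> char_poly A = \prod_(x <- s) ('X - x%:P) ->
  exists2 Q : 'M[R]_n, Q *m Q^T = 1%:M &
    A = Q^T *m diag_mx (\row_j s`_j) *m Q.
Proof.
elim: s n A => [|x s IH] n A As cA.
  have n0 : n = 0%N.
    by have := size_char_poly A; rewrite cA size_prod_XsubC => -[].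
  by subst n; exists 1%:M; apply/matrixP => -[].
have : size (char_poly A) = (size s).+2 by rewrite cA size_prod_XsubC.
rewrite size_char_poly => -[nE].
case: n => [//|n] in A As cA nE *.
have : eigenvalue A x.
  by rewrite eigenvalue_root_char cA big_cons rootM root_XsubC eqxx.
case/eigenvalueP => v vA v0.
pose c := Num.sqrt ((v *m v^T) 0 0).
have c0 : 0 < c by rewrite sqrtr_gt0 sqr_rV_gt0.
pose w := c^-1 *: v.
have w1 : (w *m w^T) 0 0 = 1.
  rewrite /w linearZ /= -scalemxAl -scalemxAr scalerA mxE.
  have -> : (v *m v^T) 0 0 = c ^+ 2 by rewrite sqr_sqrtr // ltW // sqr_rV_gt0.
  by field; rewrite gt_eqF.
have wA : w *m A = x *: w by rewrite /w -scalemxAl vA !scalerA mulrC.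
have [H HH H0] := @orthogonal_with_row R n.+1 0 w w1.
have HH' : H^T *m H = 1%:M by apply: mulmx1C.
have [B BA] : exists B, B = H *m A *m H^T by eexists.
have BT : B^T = B by rewrite BA !trmx_mul trmxK As mulmxA.
have B0 : row 0 B = x *: delta_mx 0 0.
  by rewrite BA !row_mul H0 wA -scalemxAl -H0 -row_mul HH row1.
pose A' : 'M[R]_n := @drsubmx R 1 n 1 n B.
(* The first row of [B] is [x] times a basis vector; symmetry clears the first column too. *)
have BE : B = @block_mx R 1 n 1 n x%:M 0 0 A'.
  have ur : @ursubmx R 1 n 1 n B = 0.
    apply/matrixP => a b; rewrite (ord1 a) !mxE.
    have /matrixP/(_ 0 (rshift 1 b)) := B0; rewrite !mxE /= mulr0 => <-.
    by congr (B _ _); apply/val_inj.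
  have ul : @ulsubmx R 1 n 1 n B = x%:M.
    rewrite [LHS]mx11_scalar !mxE; congr _%:M.
    have /matrixP/(_ 0 0) := B0; rewrite !mxE !eqxx mulr1 => <-.
    by congr (B _ _); apply/val_inj.
  have dl : @dlsubmx R 1 n 1 n B = 0.
    rewrite -(trmxK (@dlsubmx R 1 n 1 n B)) (trmx_dlsub (B : 'M[R]_(1 + n))).
    by rewrite BT ur trmx0.
  by rewrite -[LHS](@submxK R 1 n 1 n) ul ur dl.
have AE : A = H^T *m B *m H.
  by rewrite BA !mulmxA HH' mul1mx -mulmxA HH' mulmx1.
have A's : A'^T = A' by rewrite /A' (trmx_drsub (B : 'M[R]_(1 + n))) BT.
have cA' : char_poly A' = \prod_(y <- s) ('X - y%:P).
  have X0 : 'X - x%:P != 0 :> {poly R} by rewrite polyXsubC_eq0.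
  (* After multiplication by ['X - x%:P] the left side becomes the characteristic polynomial of [B],
     which is conjugate to [A]. *)
  apply: (mulfI X0); transitivity (char_poly A); last by rewrite cA big_cons.
  have -> : char_poly A = char_poly B.
    rewrite /char_poly /char_poly_mx AE !map_mxM.
    rewrite [in LHS](_ : 'X%:M =
        map_mx polyC H^T *m 'X%:M *m map_mx polyC H); last first.
      by rewrite scalar_mxC -mulmxA -map_mxM HH' map_mx1 mulmx1.
    rewrite -mulmxBl -mulmxBr !det_mulmx mulrAC -det_mulmx -map_mxM HH'.
    by rewrite map_mx1 det1 mul1r.
  rewrite BE /char_poly /char_poly_mx (@map_block_mx _ _ _ 1 n 1 n).
  rewrite (@scalar_mx_block _ 1 n) !map_mx0 (@opp_block_mx _ 1 n 1 n).
  rewrite (@add_block_mx _ 1 n 1 n) !subr0.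
  by rewrite (@det_ublock _ 1 n) det_mx11 !mxE eqxx.
have [Q QQ A'E] := IH n A' A's cA'.
exists (@block_mx R 1 n 1 n 1%:M 0 0 Q *m H).
  rewrite trmx_mul mulmxA -(mulmxA _ H) HH mulmx1.
  rewrite (tr_block_mx (1%:M : 'M[R]_1) 0 0 Q) (@mulmx_block _ 1 n 1 n 1 n).
  rewrite !trmx0 trmx1.
  by rewrite !mulmx0 !mul0mx !addr0 add0r mul1mx QQ -scalar_mx_block.
rewrite {1}AE BE trmx_mul -!mulmxA; congr (_ *m _); rewrite !mulmxA.
congr (_ *m _).
have -> : diag_mx (\row_j (x :: s)`_j) =
    block_mx x%:M 0 0 (diag_mx (\row_j s`_j)) :> 'M[R]_(1 + n).
  rewrite -[x%:M]/(@scalar_mx R 1 x).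
  have -> : \row_(j < 1 + n) (x :: s)`_j = row_mx x%:M (\row_j s`_j).
    apply/rowP => j; rewrite !mxE; case: split_ordP => l ->; rewrite !mxE //=.
    by rewrite (ord1 l).
  rewrite diag_mx_row; congr block_mx.
  by apply/matrixP => a b; rewrite (ord1 a) (ord1 b) !mxE eqxx.
rewrite (tr_block_mx (1%:M : 'M[R]_1) 0 0 Q) !(@mulmx_block _ 1 n 1 n 1 n).
rewrite !trmx0 trmx1.
rewrite !mulmx0 !mul0mx !addr0 !add0r !mul1mx !mulmx1 mul0mx.
by rewrite -A'E.
Qed.

(** * The Euclidean norm *)

Lemma norm2_ge0 (R : realType) (m : nat) (v : 'cV[R]_m) : 0 <= norm2 v.
Proof. exact: sqrtr_ge0. Qed.

Lemma norm2_sqr (R : realType) (m : nat) (v : 'cV[R]_m) :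
  norm2 v ^+ 2 = \sum_a v a 0 ^+ 2.
Proof. by rewrite sqr_sqrtr // sumr_ge0 // => a _; exact: sqr_ge0. Qed.

Lemma norm2_eq0 (R : realType) (m : nat) (v : 'cV[R]_m) :
  norm2 v = 0 -> v = 0.
Proof.
move=> v0; have := norm2_sqr v; rewrite v0 expr0n /= => /esym/eqP.
rewrite psumr_eq0 => [/allP v0'|a _]; last exact: sqr_ge0.
apply/colP => a; rewrite mxE; apply/eqP.
by have := v0' a (mem_index_enum a); rewrite sqrf_eq0.
Qed.

(** With [S] the inner product, the squared norm of [norm2 u ^+ 2 *: v - S *: u] is nonnegative and
    equals $|u|^2 (|u|^2 |v|^2 - S^2)$; the factor $|u|^2$ cancels unless [u] vanishes. *)
Lemma cauchy_schwarz_sum (R : realType) (m : nat) (u v : 'cV[R]_m) :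
  `|\sum_a u a 0 * v a 0| <= norm2 u * norm2 v.
Proof.
have uv0 : 0 <= norm2 u * norm2 v by rewrite mulr_ge0 // norm2_ge0.
rewrite -[leRHS]ger0_norm // -ler_sqr ?nnegrE // !real_normK ?num_real //.
rewrite exprMn; set S := \sum_a _.
have : 0 <= \sum_a (norm2 u ^+ 2 * v a 0 - S * u a 0) ^+ 2.
  by apply: sumr_ge0 => a _; exact: sqr_ge0.
have -> : \sum_a (norm2 u ^+ 2 * v a 0 - S * u a 0) ^+ 2 =
    norm2 u ^+ 2 * (norm2 u ^+ 2 * norm2 v ^+ 2 - S ^+ 2).
  rewrite (eq_bigr (fun a => (norm2 u ^+ 2) ^+ 2 * v a 0 ^+ 2
    - (2 * norm2 u ^+ 2 * S) * (u a 0 * v a 0)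
    + S ^+ 2 * u a 0 ^+ 2)); last first.
    by move=> a _; ring.
  rewrite big_split sumrB /= -!mulr_sumr -/S -!norm2_sqr; ring.
have [u0 _|u0] := eqVneq (norm2 u) 0.
  rewrite -exprMn [S]big1 ?expr0n ?sqr_ge0 // => a _.
  by rewrite (norm2_eq0 u0) mxE mul0r.
by rewrite pmulr_rge0 ?exprn_even_gt0 // subr_ge0.
Qed.

(** The triangle inequality for a combination of columns, obtained by pairing $w = Eu$ with itself,
    applying Cauchy-Schwarz to each column and cancelling one factor $|w|$. *)
Lemma norm2_mulmx_le (R : realType) (m k : nat) (E : 'M[R]_(m, k))
    (u : 'cV[R]_k) :
  norm2 (E *m u) <= \sum_j `|u j 0| * norm2 (col j E).
Proof.
set w := E *m u; set K := \sum_j _.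
have K0 : 0 <= K by apply: sumr_ge0 => j _; rewrite mulr_ge0 ?norm2_ge0.
have := norm2_ge0 w; rewrite le_eqVlt => /orP[/eqP <- //|w0].
rewrite -(ler_pM2r w0) -expr2 norm2_sqr.
have -> : \sum_a w a 0 ^+ 2 = \sum_j u j 0 * \sum_a (col j E) a 0 * w a 0.
  under [RHS]eq_bigr do rewrite mulr_sumr.
  rewrite exchange_big /=; apply: eq_bigr => a _.
  rewrite expr2 {1}/w mxE mulr_suml; apply: eq_bigr => j _.
  by rewrite !mxE; ring.
rewrite mulr_suml; apply: ler_sum => j _.
rewrite (le_trans (ler_norm _)) // normrM -mulrA ler_wpM2l //.
exact: cauchy_schwarz_sum.
Qed.

(** * Orthonormal eigenbases *)

Lemma symmetric_eigval_diagonalization (R : realType) (n : nat) (A : 'M[R]_n) :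
  A^T = A -> exists2 Q : 'M[R]_n, Q *m Q^T = 1%:M &
    A = Q^T *m diag_mx (\row_j eigval A j) *m Q.
Proof.
move=> As; have [s sE] := symmetric_char_poly_split As.
apply: (symmetric_diagonalization As (s := eigenvalues A)).
by rewrite (perm_big _ (perm_eigenvalues sE)).
Qed.

Lemma norm2_orthogonal (R : realType) (n : nat) (Q : 'M[R]_n) (y : 'cV[R]_n) :
  Q *m Q^T = 1%:M -> norm2 (Q *m y) = norm2 y.
Proof.
have nE (z : 'cV[R]_n) : \sum_a z a 0 ^+ 2 = (z^T *m z) 0 0.
  by rewrite mxE; apply: eq_bigr => a _; rewrite mxE expr2.
move=> /mulmx1C QQ; congr Num.sqrt.
by rewrite !nE trmx_mul -mulmxA (mulmxA Q^T) QQ mul1mx.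
Qed.

Lemma quad_form_diag (R : realType) (n : nat) (Q : 'M[R]_n) (d : 'rV[R]_n)
    (y : 'cV[R]_n) :
  (y^T *m (Q^T *m diag_mx d *m Q) *m y) 0 0 =
  \sum_l d 0 l * (Q *m y) l 0 ^+ 2.
Proof.
rewrite !mulmxA -trmx_mul -mulmxA -mulmxA mul_diag_mx mxE.
by apply: eq_bigr => l _; rewrite [_^T _ _]mxE [X in _ * X]mxE; ring.
Qed.

(** In an orthonormal eigenbasis, $l - A$ multiplies the coordinate of index $j$ by $l -
    \lambda_j$. *)
Lemma norm2_resolvent_ge (R : realType) (n : nat) (A : 'M[R]_n) (l c : R)
    (y : 'cV[R]_n) : A^T = A -> 0 <= c ->
  (forall j, c <= `|l - eigval A j|) ->
  c * norm2 y <= norm2 (l *: y - A *m y).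
Proof.
move=> As c0 cl; have [Q QQ AE] := symmetric_eigval_diagonalization As.
rewrite -(norm2_orthogonal (l *: y - A *m y) QQ) -(norm2_orthogonal y QQ).
rewrite -ler_sqr ?nnegrE ?mulr_ge0 ?norm2_ge0 //.
rewrite exprMn !norm2_sqr mulr_sumr; apply: ler_sum => a _.
have -> : Q *m (l *: y - A *m y) =
    l *: (Q *m y) - diag_mx (\row_j eigval A j) *m (Q *m y).
  by rewrite mulmxBr -scalemxAr {1}AE !mulmxA QQ mul1mx.
move: (Q *m y) => z; rewrite mul_diag_mx !mxE -mulrBl exprMn.
rewrite ler_wpM2r ?sqr_ge0 // -[leRHS]real_normK ?num_real //.
by rewrite ler_sqr ?nnegrE.
Qed.

(** * The quadratic bound for a given eigenpair *)

Lemma eigenvalue_ritz_bound (R : realType) (k m : nat) (theta : 'rV[R]_k)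
    (E : 'M[R]_(m, k)) (A2 : 'M[R]_m) (i : 'I_k) (z : 'cV[R]_(k + m)) (l dl : R)
    (dl2 : 'I_k -> R) : A2^T = A2 ->
  z != 0 -> ritz_mx theta E A2 *m z = l *: z ->
  0 <= dl -> (forall j, dl <= `|l - eigval A2 j|) ->
  (forall j, j != i -> 0 < dl2 j) ->
  (forall j, j != i -> dl2 j <= `|l - theta 0 j|) ->
  0 < dfactor E i dl dl2 ->
  `|l - theta 0 i| <= dfactor E i dl dl2 * norm2 (col i E) ^+ 2.
Proof.
move=> A2s z0 Az dl0 dlP dl2_gt0 dl2P.
rewrite /dfactor div1r invr_gt0; set f := dl - _ => f0.
pose u := usubmx z; pose y := dsubmx z.
have zE : z = col_mx u y by rewrite vsubmxK.
move: Az; rewrite zE /ritz_mx mul_block_col scale_col_mx => /eq_col_mx[Au Ay].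
have uE j : (l - theta 0 j) * u j 0 = \sum_a (col j E) a 0 * y a 0.
  have /colP/(_ j) := Au; rewrite mul_diag_mx !mxE mulrBl => <-.
  by rewrite addrAC subrr add0r; apply: eq_bigr => a _; rewrite !mxE.
have uP j : `|l - theta 0 j| * `|u j 0| <= norm2 (col j E) * norm2 y.
  by rewrite -normrM uE cauchy_schwarz_sum.
(* The lower block reads $(l - A_2) y = E u$. In the bound for $|Eu|$, the terms with $j \ne i$ are
   at most $|E_j|^2 |y|$ divided by [dl2 j]; moved to the left, they turn [dl] into [f]. *)
have yP : f * norm2 y <= `|u i 0| * norm2 (col i E).
  rewrite mulrBl lerBlDr.
  apply: (le_trans (norm2_resolvent_ge y A2s dl0 dlP)).
  rewrite -Ay addrK (le_trans (norm2_mulmx_le _ _)) // (bigD1 i) //=.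
  rewrite lerD2l mulr_suml; apply: ler_sum => j ji.
  rewrite mulrAC ler_pdivlMr ?dl2_gt0 //.
  rewrite -[X in X * dl2 j]mulrC -mulrA expr2 -[leRHS]mulrA.
  rewrite ler_wpM2l ?norm2_ge0 //; apply: le_trans (uP j).
  by rewrite mulrC ler_wpM2r // dl2P.
(* If $u_i = 0$ then $y = 0$, and the upper equations kill every other $u_j$, so [z] would
   vanish. *)
have [ui0|ui0] := eqVneq (u i 0) 0.
  have y0 : norm2 y = 0.
    apply/le_anti; rewrite norm2_ge0 andbT -(pmulr_rle0 _ f0).
    by rewrite (le_trans yP) // ui0 normr0 mul0r.
  case/negP: z0; apply/eqP; rewrite zE (norm2_eq0 y0).
  suff -> : u = 0 by rewrite col_mx0.
  apply/colP => j; rewrite [RHS]mxE; have [->//|ji] := eqVneq j i.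
  have := uP j; rewrite y0 mulr0 pmulr_rle0 ?normr_le0; first by move/eqP.
  exact: lt_le_trans (dl2_gt0 j ji) (dl2P j ji).
have ui : 0 < `|u i 0| by rewrite normr_gt0.
rewrite -(ler_pM2r ui) (le_trans (uP i)) // [leRHS]mulrC.
have := norm2_ge0 (col i E); set e := norm2 (col i E) in yP * => e0.
have -> : `|u i 0| * (f^-1 * e ^+ 2) = e * (f^-1 * (`|u i 0| * e)) by ring.
by rewrite ler_wpM2l // -(ler_pM2l f0) mulVKf ?gt_eqF.
Qed.

(** * Counting eigenvalues by dimension *)

Lemma nonzero_annihilated (F : fieldType) (n : nat) (s : seq 'rV[F]_n) :
  (size s < n)%N ->
  exists2 x : 'cV[F]_n, x != 0 & {in s, forall w, w *m x = 0}.
Proof.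
move=> sn; pose M : 'M[F]_(size s, n) := \matrix_(a < size s) s`_a.
exists (nz_row (kermx M^T))^T.
  rewrite trmx_eq0 nz_row_eq0 -mxrank_eq0 mxrank_ker subn_eq0 -ltnNge.
  by rewrite (leq_ltn_trans _ sn) // rank_leq_col.
move=> w /(nthP 0)[a asz <-].
have /sub_kermxP/(congr1 trmx) := nz_row_sub (kermx M^T).
rewrite trmx_mul trmxK trmx0 => Mx.
have := row_mul (Ordinal asz) M (nz_row (kermx M^T))^T.
by rewrite Mx row0 rowK.
Qed.

Lemma card_trichotomy (T : finType) (R : realDomainType) (f : T -> R) (c : R) :
  (#|[pred j | (f j < c)%R]| + #|[pred j | (c < f j)%R]|
   + #|[pred j | f j == c]| =
   #|T|)%N.
Proof.
rewrite -!sum1_card big_mkcond [X in (_ + X + _)%N]big_mkcond.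
rewrite [X in (_ + X)%N = _]big_mkcond -!big_split /=; apply: eq_bigr => j _.
by rewrite !inE; case: ltgtP.
Qed.

Lemma quad_form_ritz (R : realType) (k m : nat) (theta : 'rV[R]_k)
    (E : 'M[R]_(m, k)) (A2 : 'M[R]_m) (u : 'cV[R]_k) (y : 'cV[R]_m) :
  ((col_mx u y)^T *m ritz_mx theta E A2 *m col_mx u y) 0 0 =
  \sum_j (theta 0 j * u j 0 ^+ 2 + 2 * (u j 0 * \sum_a (col j E) a 0 * y a 0))
  + (y^T *m A2 *m y) 0 0.
Proof.
rewrite -!mulmxA mul_block_col tr_col_mx mul_row_col !mulmxDr.
have uEy : (u^T *m (E^T *m y)) 0 0 =
    \sum_j u j 0 * \sum_a (col j E) a 0 * y a 0.
  rewrite mxE; apply: eq_bigr => j _; rewrite !mxE; congr (_ * _).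
  by apply: eq_bigr => a _; rewrite !mxE.
have -> : y^T *m (E *m u) = u^T *m (E^T *m y).
  by rewrite [LHS]mx11_scalar -tr_scalar_mx -mx11_scalar !trmx_mul trmxK mulmxA.
have uDu : (u^T *m (diag_mx theta *m u)) 0 0 =
    \sum_j theta 0 j * u j 0 ^+ 2.
  rewrite mul_diag_mx mxE; apply: eq_bigr => j _.
  by rewrite [_^T _ _]mxE [X in _ * X]mxE; ring.
have addE (M N : 'M[R]_1) : (M + N) 0 0 = M 0 0 + N 0 0 by rewrite mxE.
by rewrite !addE uDu uEy big_split /= -mulr_sumr; ring.
Qed.

Lemma norm2_col_mx (R : realType) (k m : nat) (u : 'cV[R]_k) (y : 'cV[R]_m) :
  norm2 (col_mx u y) ^+ 2 = \sum_j u j 0 ^+ 2 + norm2 y ^+ 2.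
Proof.
rewrite !norm2_sqr big_split_ord /=; congr (_ + _); apply: eq_bigr => a _.
  by rewrite col_mxEu.
by rewrite col_mxEd.
Qed.

(* If the count failed, some nonzero z = (u, y) would avoid the eigenvectors of
   the ritz matrix below theta_i + |E_i|, those of A2 above theta_i, and satisfy
   u_j = - E_j.y / (theta_j - theta_i) whenever theta_j > theta_i. Completing
   squares then bounds its Rayleigh quotient by theta_i + |E_i|. *)
Lemma ritz_count (R : realType) (k m : nat) (theta : 'rV[R]_k)
    (E : 'M[R]_(m, k)) (A2 : 'M[R]_m) (i : 'I_k) (mu : 'rV[R]_(k + m))
    (nu : 'rV[R]_m) (Q : 'M[R]_(k + m)) (P : 'M[R]_m) (D : R) (g : 'I_k -> R) :
  Q *m Q^T = 1%:M -> ritz_mx theta E A2 = Q^T *m diag_mx mu *m Q ->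
  P *m P^T = 1%:M -> A2 = P^T *m diag_mx nu *m P ->
  (forall j, D <= `|theta 0 i - nu 0 j|) ->
  (forall j, j != i -> 0 < g j) ->
  (forall j, j != i -> g j <= `|theta 0 i - theta 0 j|) ->
  \sum_(j < k | j != i) norm2 (col j E) ^+ 2 / g j <= D ->
  (#|[pred j | (theta 0 j < theta 0 i)%R]| +
     #|[pred j | (nu 0 j < theta 0 i)%R]| <
   #|[pred l | (mu 0 l <= theta 0 i + norm2 (col i E))%R]|)%N.
Proof.
move=> QQ AE PP A2E DP g0 gP sD; set t := theta 0 i; set e := norm2 (col i E).
rewrite ltnNge; apply/negP => cnt.
pose sJ := [seq row_mx (delta_mx 0 j) ((theta 0 j - t)^-1 *: (col j E)^T)
  | j <- enum [pred j | t < theta 0 j]].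
pose sK := [seq row_mx (0 : 'rV[R]_k) (row j P)
  | j <- enum [pred j | t < nu 0 j]].
pose sL := [seq row l Q | l <- enum [pred l | mu 0 l <= t + e]].
have [|z z0 zs] := @nonzero_annihilated R (k + m) (sJ ++ sK ++ sL).
  have szJ : size sJ = #|[pred j | t < theta 0 j]| by rewrite size_map -cardE.
  have szK : size sK = #|[pred j | t < nu 0 j]| by rewrite size_map -cardE.
  have szL : size sL = #|[pred l | mu 0 l <= t + e]|.
    by rewrite size_map -cardE.
  have ck : (#|[pred j | (theta 0 j < t)%R]| + #|[pred j | (t < theta 0 j)%R]|
      + #|[pred j | (theta 0 j == t)%R]| = k)%N.
    by rewrite -[RHS]card_ord; exact: card_trichotomy.
  have cm : (#|[pred j | (nu 0 j < t)%R]| + #|[pred j | (t < nu 0 j)%R]|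
      + #|[pred j | (nu 0 j == t)%R]| = m)%N.
    by rewrite -[RHS]card_ord; exact: card_trichotomy.
  (* The index [i] itself is neither below nor above [t]; this leaves at most [k + m - 1] linear
     conditions. *)
  have : (0 < #|[pred j | (theta 0 j == t)%R]|)%N.
    by apply/card_gt0P; exists i; rewrite inE /= eqxx.
  rewrite !size_cat szJ szK szL; move: cnt ck cm; clear; lia.
pose u := usubmx z; pose y := dsubmx z.
have zE : z = col_mx u y by rewrite vsubmxK.
pose b j := \sum_a (col j E) a 0 * y a 0.
pose N := norm2 y.
have N0 : 0 <= N by exact: norm2_ge0.
have bP j : b j ^+ 2 <= norm2 (col j E) ^+ 2 * N ^+ 2.
  rewrite -exprMn -[leLHS]real_normK ?num_real // ler_sqr ?nnegrE //.
    exact: cauchy_schwarz_sum.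
  by rewrite mulr_ge0 ?norm2_ge0.
have hJ j : t < theta 0 j -> (theta 0 j - t) * u j 0 = - b j.
  move=> tj.
  have : row_mx (delta_mx 0 j) ((theta 0 j - t)^-1 *: (col j E)^T) *m z = 0.
    apply: zs; rewrite mem_cat; apply/orP; left.
    by apply: (map_f (fun j => _)); rewrite mem_enum.
  rewrite zE mul_row_col -rowE => /matrixP/(_ 0 0).
  rewrite -scalemxAl !mxE.
  have -> : \sum_a (col j E)^T 0 a * y a 0 = b j.
    by apply: eq_bigr => a _; rewrite mxE.
  have tj0 : theta 0 j - t != 0 by rewrite subr_eq0 gt_eqF.
  move/eqP; rewrite addr_eq0 => /eqP ->.
  by rewrite mulrN mulVKf.
have hK j : t < nu 0 j -> (P *m y) j 0 = 0.
  move=> tj; have : row_mx (0 : 'rV[R]_k) (row j P) *m z = 0.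
    apply: zs; rewrite !mem_cat; apply/orP; right; apply/orP; left.
    by apply: (map_f (fun j => _)); rewrite mem_enum.
  rewrite zE mul_row_col mul0mx add0r -row_mul => /matrixP/(_ 0 0).
  by rewrite [LHS]mxE [RHS]mxE.
have hL l : mu 0 l <= t + e -> (Q *m z) l 0 = 0.
  move=> tl; have : row l Q *m z = 0.
    apply: zs; rewrite !mem_cat; apply/orP; right; apply/orP; right.
    by apply: (map_f (fun j => _)); rewrite mem_enum.
  by rewrite -row_mul => /matrixP/(_ 0 0); rewrite [LHS]mxE [RHS]mxE.
have upper : (z^T *m ritz_mx theta E A2 *m z) 0 0 <= (t + e) * norm2 z ^+ 2.
  rewrite zE quad_form_ritz norm2_col_mx -/N.
  (* The surviving components of [y] have [nu 0 j <= t], hence [nu 0 j <= t - D] by the gap. *)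
  have hy : (y^T *m A2 *m y) 0 0 <= (t - D) * N ^+ 2.
    rewrite A2E quad_form_diag /N -(norm2_orthogonal y PP) norm2_sqr mulr_sumr.
    apply: ler_sum => j _; have [tj|tj] := ltP t (nu 0 j).
      by rewrite hK // expr0n !mulr0.
    rewrite ler_wpM2r ?sqr_ge0 //.
    by have := DP j; rewrite -/t ger0_norm ?subr_ge0 // lerBrDl addrC -lerBrDl.
  (* The coupling through $E_i$ costs $2 |u_i| e N \le e (u_i^2 + N^2)$. *)
  have hi : theta 0 i * u i 0 ^+ 2 + 2 * (u i 0 * b i) <=
      t * u i 0 ^+ 2 + e * (u i 0 ^+ 2 + N ^+ 2).
    rewrite lerD2l.
    have : u i 0 * b i <= `|u i 0| * (e * N).
      rewrite (le_trans (ler_norm _)) // normrM ler_wpM2l //.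
      exact: cauchy_schwarz_sum.
    have : 0 <= e * (`|u i 0| - N) ^+ 2 by rewrite mulr_ge0 ?sqr_ge0 ?norm2_ge0.
    rewrite -(real_normK (num_real (u i 0))); move: (`|_|) (u i 0 * _) => a x.
    by rewrite sqrrB; lra.
  (* Above [t], the relation [hJ] makes the excess $-(\theta_j - t) u_j^2 \le 0$. Below [t],
     completing the square against the gap [g j] costs at most $|E_j|^2 N^2$ divided by [g j]. *)
  have hj j : j != i -> theta 0 j * u j 0 ^+ 2 + 2 * (u j 0 * b j) <=
      t * u j 0 ^+ 2 + norm2 (col j E) ^+ 2 / g j * N ^+ 2.
    move=> ji; have gj := g0 j ji; have gjP := gP j ji.
    have rhs0 : 0 <= norm2 (col j E) ^+ 2 / g j * N ^+ 2.
      by rewrite !mulr_ge0 ?invr_ge0 ?exprn_ge0 ?norm2_ge0 // ltW.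
    rewrite -lerBlDl.
    have [tj|jt] := ltP t (theta 0 j).
      apply: le_trans rhs0; have ub := hJ j tj.
      have -> : theta 0 j * u j 0 ^+ 2 + 2 * (u j 0 * b j) - t * u j 0 ^+ 2 =
          - ((theta 0 j - t) * u j 0 ^+ 2).
        have -> : b j = - ((theta 0 j - t) * u j 0) by rewrite ub opprK.
        by ring.
      by rewrite oppr_le0 mulr_ge0 ?sqr_ge0 // subr_ge0 ltW.
    rewrite mulrAC ler_pdivlMr //; apply: le_trans (bP j).
    move: gjP; rewrite -/t ger0_norm ?subr_ge0 // => gjP.
    rewrite -subr_ge0.
    have -> : b j ^+ 2 - (theta 0 j * u j 0 ^+ 2 + 2 * (u j 0 * b j)
          - t * u j 0 ^+ 2) * g j =
        (b j - g j * u j 0) ^+ 2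
          + g j * (t - theta 0 j - g j) * u j 0 ^+ 2 by ring.
    rewrite addr_ge0 ?sqr_ge0 // mulr_ge0 ?sqr_ge0 //.
    by rewrite mulr_ge0 ?subr_ge0 ?(ltW gj).
  (* The total cost is at most $D N^2$, which the term $-D N^2$ of [hy] compensates. *)
  have hS : \sum_(j < k | j != i) (theta 0 j * u j 0 ^+ 2 + 2 * (u j 0 * b j))
      <= t * \sum_(j < k | j != i) u j 0 ^+ 2 + D * N ^+ 2.
    apply: (le_trans (ler_sum _ hj)).
    by rewrite big_split /= -mulr_sumr lerD2l -mulr_suml ler_wpM2r ?sqr_ge0.
  rewrite (bigD1 i) //= [X in _ * (X + _)](bigD1 i) //= -/(b i).
  (* The coordinates that [hi] leaves out of $e |z|^2$ contribute only nonnegative slack. *)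
  have : 0 <= e * \sum_(j < k | j != i) u j 0 ^+ 2.
    by rewrite mulr_ge0 ?norm2_ge0 // sumr_ge0 // => j _; rewrite sqr_ge0.
  by move: hy hi hS; rewrite /b; lra.
have := upper; rewrite AE quad_form_diag -(norm2_orthogonal z QQ) norm2_sqr.
rewrite mulr_sumr -subr_le0 -sumrB => le0.
(* By [hL], only eigenvectors with [mu 0 l > t + e] enter [z], so every term is nonnegative while
   the sum is at most zero: all terms vanish and [z = 0]. *)
have ge0 l : 0 <= mu 0 l * (Q *m z) l 0 ^+ 2 - (t + e) * (Q *m z) l 0 ^+ 2.
  rewrite -mulrBl; have [/hL ->|lt] := leP (mu 0 l) (t + e).
    by rewrite expr0n mulr0.
  by rewrite mulr_ge0 ?sqr_ge0 // subr_ge0 ltW.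
have : \sum_l (mu 0 l * (Q *m z) l 0 ^+ 2 - (t + e) * (Q *m z) l 0 ^+ 2) == 0.
  by rewrite eq_le le0 sumr_ge0.
rewrite psumr_eq0 // => /allP eq0.
case/negP: z0; apply/eqP/norm2_eq0; rewrite -(norm2_orthogonal z QQ).
suff -> : Q *m z = 0.
  by rewrite /norm2 big1 ?sqrtr0 // => a _; rewrite mxE expr0n.
apply/colP => l; rewrite [RHS]mxE; have [/hL//|lt] := leP (mu 0 l) (t + e).
have := eq0 l (mem_index_enum l).
by rewrite -mulrBl mulf_eq0 subr_eq0 gt_eqF //= sqrf_eq0 => /eqP.
Qed.

(** * From counts to bounds on ordered eigenvalues *)

Lemma card_ord_lt (n p : nat) : (p <= n)%N -> #|[pred l : 'I_n | l < p]%N| = p.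
Proof.
move=> pn; rewrite -sum1_card -(big_ord_widen n (fun=> 1%N) pn) sum1_card.
exact: card_ord.
Qed.

Lemma eigval_homo (R : rcfType) (n : nat) (A : 'M[R]_n) (j l : 'I_n) :
  A^T = A -> (j <= l)%N -> eigval A j <= eigval A l.
Proof.
move=> As; apply: (sorted_leq_nth le_trans le_refl _ (eigenvalues_sorted A));
  by rewrite inE size_eigenvalues.
Qed.

(** By monotonicity, if the eigenvalue of index [p] exceeded [c], only the [p] smaller indices could
    carry eigenvalues at most [c]. *)
Lemma eigval_le_card (R : rcfType) (n : nat) (A : 'M[R]_n) (p : 'I_n) (c : R) :
  A^T = A -> (p < #|[pred l | (eigval A l <= c)%R]|)%N -> eigval A p <= c.
Proof.
move=> As; apply: contraTT; rewrite -ltNge -leqNgt => cp.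
rewrite -[leqRHS](card_ord_lt (ltnW (ltn_ord p))).
apply/subset_leq_card/fintype.subsetP => l; rewrite !inE => lc.
rewrite ltnNge; apply/negP => /(eigval_homo As).
by rewrite leNgt (le_lt_trans lc cp).
Qed.

(** Dually, if the eigenvalue of index [p] were below [c], so would be the first [p + 1], leaving at
    most [n - p - 1] others. *)
Lemma eigval_ge_card (R : rcfType) (n : nat) (A : 'M[R]_n) (p : 'I_n) (c : R) :
  A^T = A -> (n <= p + #|[pred l | (c <= eigval A l)%R]|)%N -> c <= eigval A p.
Proof.
move=> As; apply: contraTT; rewrite -ltNge -ltnNge => pc.
have := cardC [pred l : 'I_n | l < p.+1]%N.
rewrite card_ord_lt // card_ord => nE.
rewrite -[ltnRHS]nE addSn ltnS leq_add2l.
apply/subset_leq_card/fintype.subsetP => l; rewrite !inE => lc.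
apply/negP; rewrite ltnS => /(eigval_homo As).
by rewrite leNgt (lt_le_trans pc lc).
Qed.

Lemma eigenvalue_eigval (R : rcfType) (n : nat) (A : 'M[R]_n) (p : 'I_n) :
  A^T = A -> eigenvalue A (eigval A p).
Proof.
move=> As; rewrite eigenvalue_root_char char_poly_eigval //.
by rewrite (bigD1 p) //= rootM root_XsubC eqxx.
Qed.

Lemma symmetric_ritz_mx (R : realType) (k m : nat) (theta : 'rV[R]_k)
    (E : 'M[R]_(m, k)) (A2 : 'M[R]_m) :
  A2^T = A2 -> (ritz_mx theta E A2)^T = ritz_mx theta E A2.
Proof. by move=> A2s; rewrite tr_block_mx trmxK A2s tr_diag_mx. Qed.

(** * The eigenvalue attached to a separated Ritz value *)

Section RitzSeparated.
Context {R : realType} {k m : nat} (theta : 'rV[R]_k) (E : 'M[R]_(m, k)).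
Context (A2 : 'M[R]_m) (A2s : A2^T = A2).

Lemma delta_le (i : 'I_k) (j : 'I_m) :
  delta theta E A2 i + norm2 (col i E) <= `|theta 0 i - eigval A2 j|.
Proof.
rewrite /delta subrK; apply: ge_inf; last by exists j.
by exists 0 => _ [l _ <-].
Qed.

Lemma ritz_separated_sum_le (i : 'I_k) : ritz_separated theta E A2 i ->
  \sum_(j < k | j != i) norm2 (col j E) ^+ 2 / delta2 theta E i j <=
  delta theta E A2 i.
Proof. by case=> _ _; rewrite /dfactor div1r invr_gt0 subr_gt0 => /ltW. Qed.

(** Replacing $\theta_i$ by [l] shortens each distance by at most $|E_i|$, exactly the amount
    already subtracted in [delta] and [delta2]. *)
Lemma ritz_eigval_bound (i : 'I_k) (l : R) (z : 'cV[R]_(k + m)) :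
  ritz_separated theta E A2 i -> z != 0 ->
  ritz_mx theta E A2 *m z = l *: z ->
  `|l - theta 0 i| <= norm2 (col i E) ->
  `|l - theta 0 i| <= ritz_bound theta E A2 i.
Proof.
case=> d0 d20 f0 z0 Az le.
have far (x : R) : `|theta 0 i - x| - norm2 (col i E) <= `|l - x|.
  rewrite lerBlDr (le_trans (ler_distD l _ _)) // addrC lerD2l.
  by rewrite distrC.
apply: (eigenvalue_ritz_bound A2s z0 Az (ltW d0)) => // j.
  by apply: le_trans (far _); rewrite lerBrDr; exact: delta_le.
by move=> _; exact: far.
Qed.

Definition ritz_position (i : 'I_k) : nat :=
  (#|[pred j | (theta 0 j < theta 0 i)%R]|
   + #|[pred j | (eigval A2 j < theta 0 i)%R]|)%N.

(** Both counts are monotone, and the first grows strictly because [i] itself lies below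
    [theta 0 j]. Distinct Ritz values thus get distinct positions. *)
Lemma ritz_position_lt (i j : 'I_k) :
  theta 0 i < theta 0 j -> (ritz_position i < ritz_position j)%N.
Proof.
move=> ij; rewrite -addSn leq_add //; last first.
  apply/subset_leq_card/fintype.subsetP => l; rewrite !inE => /lt_trans.
  exact.
apply: proper_card; apply/properP; split.
  by apply/fintype.subsetP => l; rewrite !inE => /lt_trans; apply.
by exists i; rewrite !inE // ltxx.
Qed.

(** The count [ritz_count] gives the upper bound when applied to the matrix and the lower bound when
    applied to its negative. Since no other $\theta_j$ and no eigenvalue of [A2] equals $\theta_i$,
    the two counts are complementary and point to the same index. *)
Lemma eigval_ritz_position (i : 'I_k) : ritz_separated theta E A2 i ->
  exists2 p : 'I_(k + m), val p = ritz_position i &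
    `|eigval (ritz_mx theta E A2) p - theta 0 i| <= norm2 (col i E).
Proof.
move=> sep; have [d0 d20 _] := sep.
have As := symmetric_ritz_mx theta E A2s.
have [Q QQ AE] := symmetric_eigval_diagonalization As.
have [P PP A2E] := symmetric_eigval_diagonalization A2s.
have dP j : delta theta E A2 i <= `|theta 0 i - eigval A2 j|.
  apply: le_trans (delta_le i j).
  by rewrite lerDl norm2_ge0.
have d2P j : j != i -> delta2 theta E i j <= `|theta 0 i - theta 0 j|.
  by rewrite lerBlDr lerDl norm2_ge0.
have cnt : (ritz_position i < #|[pred l | (eigval (ritz_mx theta E A2) l <=
    theta 0 i + norm2 (col i E))%R]|)%N.
  have := @ritz_count R k m theta E A2 i _ _ Q P (delta theta E A2 i)
    (delta2 theta E i) QQ AE PP A2E.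
  have -> : #|[pred l | (\row_j eigval (ritz_mx theta E A2) j) 0 l <=
      theta 0 i + norm2 (col i E)]| = #|[pred l | (eigval (ritz_mx theta E A2) l
      <= theta 0 i + norm2 (col i E))%R]|.
    by apply: eq_card => l; rewrite !inE mxE.
  have -> : #|[pred j | (\row_j eigval A2 j) 0 j < theta 0 i]| =
      #|[pred j | (eigval A2 j < theta 0 i)%R]|.
    by apply: eq_card => l; rewrite !inE mxE.
  apply=> //; last exact: ritz_separated_sum_le.
  by move=> j; rewrite mxE.
have cnt' : (#|[pred j | (theta 0 i < theta 0 j)%R]|
    + #|[pred j | (theta 0 i < eigval A2 j)%R]| <
    #|[pred l | (theta 0 i - norm2 (col i E) <=
      eigval (ritz_mx theta E A2) l)%R]|)%N.
  (* Negation keeps [Q], [P], the gaps and the column norms and reverses all order relations. *)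
  have := @ritz_count R k m (- theta) (- E) (- A2) i
    (- \row_j eigval (ritz_mx theta E A2) j) (- \row_j eigval A2 j)
    Q P (delta theta E A2 i) (delta2 theta E i) QQ _ PP.
  have nE j : norm2 (col j (- E)) = norm2 (col j E).
    by congr Num.sqrt; apply: eq_bigr => a _; rewrite !mxE sqrrN.
  have -> : #|[pred l | (- \row_j eigval (ritz_mx theta E A2) j) 0 l <=
      (- theta) 0 i + norm2 (col i (- E))]| =
      #|[pred l | (theta 0 i - norm2 (col i E) <=
      eigval (ritz_mx theta E A2) l)%R]|.
    by apply: eq_card => l; rewrite !inE nE !mxE -[LHS]lerN2 opprD !opprK.
  have -> : #|[pred j | (- \row_j eigval A2 j) 0 j < (- theta) 0 i]| =
      #|[pred j | (theta 0 i < eigval A2 j)%R]|.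
    by apply: eq_card => l; rewrite !inE !mxE ltrN2.
  have -> : #|[pred j | (- theta) 0 j < (- theta) 0 i]| =
      #|[pred j | (theta 0 i < theta 0 j)%R]|.
    by apply: eq_card => l; rewrite !inE !mxE ltrN2.
  have diagN n (v : 'rV[R]_n) : diag_mx (- v) = - diag_mx v.
    by rewrite linearN.
  apply=> //.
  - rewrite diagN mulmxN mulNmx -AE /ritz_mx opp_block_mx diagN.
    by rewrite linearN.
  - by rewrite diagN mulmxN mulNmx -A2E.
  - by move=> j; rewrite !mxE -opprD normrN dP.
  - by move=> j ji; rewrite !mxE -opprD normrN d2P.
  under eq_bigr do rewrite nE.
  exact: ritz_separated_sum_le.
have card_eq1 : #|[pred j | (theta 0 j == theta 0 i)%R]| = 1%N.
  rewrite -[RHS](card1 i); apply: eq_card => j; rewrite !inE.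
  have [->|ji] := eqVneq j i; first by rewrite eqxx.
  apply/negP => /eqP E0; have := lt_le_trans (d20 j ji) (d2P j ji).
  by rewrite E0 subrr normr0 ltxx.
have ck : (#|[pred j | (theta 0 j < theta 0 i)%R]|
    + #|[pred j | (theta 0 i < theta 0 j)%R]| + 1 = k)%N.
  rewrite -[X in (_ + X)%N]card_eq1 -[RHS]card_ord.
  exact: card_trichotomy.
have cm : (#|[pred j | (eigval A2 j < theta 0 i)%R]|
    + #|[pred j | (theta 0 i < eigval A2 j)%R]| = m)%N.
  rewrite -[RHS]card_ord -(card_trichotomy (eigval A2) (theta 0 i)).
  rewrite [X in _ = (_ + X)%N]eq_card0 ?addn0 // => j; rewrite inE /=.
  apply/negP => /eqP E0; have := dP j; by rewrite E0 subrr normr0 leNgt d0.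
have pn : (ritz_position i < k + m)%N.
  by move: ck cm; rewrite /ritz_position; clear; lia.
exists (Ordinal pn) => //; rewrite ler_distl; apply/andP; split.
  (* The entries of [theta] and eigenvalues of [A2] above $\theta_i$ number
     [k + m - 1 - ritz_position i]. *)
  have above N : (#|[pred j | (theta 0 i < theta 0 j)%R]|
      + #|[pred j | (theta 0 i < eigval A2 j)%R]| < N ->
      k + m <= ritz_position i + N)%N.
    by move: ck cm; rewrite /ritz_position; clear; lia.
  by apply: eigval_ge_card => //; apply: above.
exact: eigval_le_card.
Qed.

End RitzSeparated.

End RitzPerturbation.

(** * Existence, one-to-one correspondence and the bound along a path *)

Theorem theorem1 (R : realType) (k m : nat) (hk : (1 <= k)%N) (hm : (1 <= m)%N)
    (theta : 'rV[R]_k) (E : 'M[R]_(m, k)) (A2 : 'M[R]_m) (hA2 : A2^T = A2) :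
  [/\ forall i : 'I_k, ritz_separated theta E A2 i ->
        exists2 l : R, eigenvalue (ritz_mx theta E A2) l &
          `|l - theta 0 i| <= ritz_bound theta E A2 i,
      (forall i : 'I_k, ritz_separated theta E A2 i) ->
        exists2 s : 'I_k -> 'I_(k + m), injective s &
          forall i : 'I_k,
            `|eigval (ritz_mx theta E A2) (s i) - theta 0 i|
              <= ritz_bound theta E A2 i
    & forall (i : 'I_k) (x : R -> 'cV[R]_(k + m)) (lam : R -> R)
        (dl : R) (dl2 : 'I_k -> R),
        {within `[0, 1], continuous x} ->
        {within `[0, 1], continuous lam} ->
        (forall t : R, 0 <= t <= 1 -> x t != 0) ->
        (forall t : R, 0 <= t <= 1 ->
           ritz_mx theta (scale_col i t E) A2 *m x t = lam t *: x t) ->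
        lam 0 = theta 0 i ->
        0 < dl ->
        (forall (t : R) (j : 'I_m), 0 <= t <= 1 ->
           dl <= `|lam t - eigval A2 j|) ->
        (forall j : 'I_k, j != i -> 0 < dl2 j) ->
        (forall (t : R) (j : 'I_k), 0 <= t <= 1 -> j != i ->
           dl2 j <= `|lam t - theta 0 j|) ->
        0 < dfactor E i dl dl2 ->
        `|lam 1 - theta 0 i| <= dfactor E i dl dl2 * norm2 (col i E) ^+ 2].
Proof.
have As := symmetric_ritz_mx theta E hA2.
have bound i p : ritz_separated theta E A2 i ->
    `|eigval (ritz_mx theta E A2) p - theta 0 i| <= norm2 (col i E) ->
    `|eigval (ritz_mx theta E A2) p - theta 0 i| <= ritz_bound theta E A2 i.
  move=> sep; have /eigenvalueP[v vA v0] := eigenvalue_eigval p As.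
  apply: (ritz_eigval_bound hA2 (z := v^T)) => //; first by rewrite trmx_eq0.
  (* By symmetry, the transpose of a left eigenvector is a right eigenvector. *)
  by rewrite -{1}As -trmx_mul vA linearZ.
split.
- move=> i sep; have [p _ pi] := eigval_ritz_position hA2 sep.
  exists (eigval (ritz_mx theta E A2) p); last exact: bound.
  exact: eigenvalue_eigval.
- move=> sep.
  have /boolp.choice[s sP] : forall i, exists p : 'I_(k + m),
      val p = ritz_position theta A2 i /\
      `|eigval (ritz_mx theta E A2) p - theta 0 i| <= norm2 (col i E).
    by move=> i; have [p ? ?] := eigval_ritz_position hA2 (sep i); exists p.
  exists s; last by move=> i; apply: bound => //; exact: (sP i).2.
  move=> i j /(congr1 val); rewrite (sP i).1 (sP j).1.
  have [//|ji] := eqVneq j i.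
  (* Equal positions force equal Ritz values, and then [delta2] would be $-|E_i| \le 0$. *)
  have [lt|lt|eq] := ltgtP (theta 0 i) (theta 0 j).
  + by have := ritz_position_lt A2 lt; lia.
  + by have := ritz_position_lt A2 lt; lia.
  have [_ /(_ j ji) d20 _] := sep i; move: d20.
  by rewrite /delta2 eq subrr normr0 sub0r oppr_gt0 ltNge norm2_ge0.
move=> i x lam dl dl2 _ _ x0 xP _ dl0 dlP dl20 dl2P f0.
(* At [t = 1] the scaled matrix is the original one, so [x 1] and [lam 1] form an eigenpair to which
   the uniform gaps apply. *)
have t1 : 0 <= (1 : R) <= 1 by rewrite ler01 lexx.
have E1 : scale_col i 1 E = E.
  by apply/matrixP => a b; rewrite mxE mul1r if_same.
apply: (eigenvalue_ritz_bound hA2 (x0 1 t1) _ (ltW dl0)) => //.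
- by rewrite -xP // E1.
- by move=> j; exact: dlP.
by move=> j; exact: dl2P.
Qed.
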